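(* Let $n\ge 1$. If $X\in\widehat F_n$ is group-like, then $\log(X)=\widehat{\mathrm{cbh}}_n(X)$.
   Context: Work over a field of characteristic $0$. $F_n$ is the free associative (unital) algebra generated by free variables $x_1,\dots,x_n$, and $\mathfrak f_n\subset F_n$ is the free Lie algebra with the same generators, i.e. the Lie subalgebra of $F_n$ (for the commutator bracket) generated by $x_1,\dots,x_n$. $\widehat F_n$ and $\widehat{\mathfrak f}_n$ are their degree completions, where each $x_i$ has degree $1$. A group-like element of $\widehat F_n$ is an element of the form $X=1+(\text{terms of degree}>0)$ such that $\Delta(X)=X\otimes X$, where $\Delta$ is the completion of the coproduct $F_n\to F_n^{\otimes 2}$, the algebra morphism for which $x_1,\dots,x_n$ are primitive ($x_i\mapsto x_i\otimes 1+1\otimes x_i$). The exponential is a bijection $\exp:\widehat{\mathfrak f}_n\to\{\text{group-like elements of }\widehat F_n\}$, and $\log$ denotes the inverse bijection. For $k\ge 1$, $\mathrm{CBH}_k(x_1,\dots,x_k)\in\mathfrak f_k$ denotes the multilinear part in $x_1,\dots,x_k$ (the sum of the terms of degree exactly $1$ in each of $x_1,\dots,x_k$) of $\log(e^{x_1}\cdots e^{x_k})$. Being a Lie polynomial, it can be evaluated at any $k$ elements of a Lie algebra. The linear map $\mathrm{cbh}_n:F_n\to\mathfrak f_n$ is defined on the basis of monomials by $\mathrm{cbh}_n(1)=0$ and $\mathrm{cbh}_n(x_{i_1}\cdots x_{i_k})=\mathrm{CBH}_k(x_{i_1},\dots,x_{i_k})$ for $k\ge1$ and $i_1,\dots,i_k\in\{1,\dots,n\}$.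 It is degree-preserving, and $\widehat{\mathrm{cbh}}_n:\widehat F_n\to\widehat{\mathfrak f}_n$ is its extension to the degree completions. *)

(* Defs.v *)
From HB Require Import structures.
From mathcomp Require Import all_boot all_algebra.
From mathcomp Require Import finmap.
From mathcomp.multinomials Require Import monalg.
From mathcomp Require Import boolp classical_sets.

Set Implicit Arguments.
Unset Strict Implicit.
Unset Printing Implicit Defensive.

Import GRing.Theory.
Local Open Scope ring_scope.

(* The free associative algebra on x_0, ..., x_(n-1): the monoid algebra of   *)
(* the free monoid of words in the letters 'I_n.                              *)
Notation freealg K n := {malg K[{fmonom 'I_n}]}.

Definition genF (K : fieldType) (n : nat) (i : 'I_n) : freealg K n :=
  << fmu i >>.

(* The algebra morphism x_j |-> a j. If the a j lie in a Lie subalgebra of    *)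
(* the target, then on the free Lie algebra inside freealg K k this is the    *)
(* Lie morphism x_j |-> a j, that is, the evaluation of Lie polynomials.      *)
Definition evalF (K : fieldType) (k n : nat) (a : 'I_k -> freealg K n)
    (P : freealg K k) : freealg K n :=
  mmap (@malgC {fmonom 'I_n} K) (fun w : {fmonom 'I_k} => \prod_(j <- w) a j) P.

Inductive free_lie (K : fieldType) (n : nat) : freealg K n -> Prop :=
| free_lie_gen (i : 'I_n) : free_lie (genF K i)
| free_lie_zero : free_lie 0
| free_lie_add (P Q : freealg K n) :
    free_lie P -> free_lie Q -> free_lie (P + Q)
| free_lie_scale (c : K) (P : freealg K n) : free_lie P -> free_lie (c *: P)
| free_lie_bracket (P Q : freealg K n) :
    free_lie P -> free_lie Q -> free_lie (P * Q - Q * P).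

(* The degree completion of freealg K n: arbitrary families of coefficients   *)
(* indexed by words, with the product extending concatenation of words.       *)
Definition series (K : fieldType) (n : nat) : Type := {fmonom 'I_n} -> K.

Section SeriesAlgebra.
Variables (K : fieldType) (n : nat).
Implicit Types (c : K) (X Y Z : series K n) (w : {fmonom 'I_n}).

HB.instance Definition _ := gen_eqMixin (series K n).
HB.instance Definition _ := gen_choiceMixin (series K n).

Definition series0 : series K n := fun=> 0.
Definition series_opp X : series K n := fun w => - X w.
Definition series_add X Y : series K n := fun w => X w + Y w.
Definition series_scale c X : series K n := fun w => c * X w.
Definition series1 : series K n := fun w => (size w == 0%N)%:R.
Definition series_mul X Y : series K n := fun w =>
  \sum_(i < (size w).+1) X (FMonom (take i w)) * Y (FMonom (drop i w)).

Fact series_addA : associative series_add.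
Proof. by move=> X Y Z; apply/funext => w; rewrite /series_add addrA. Qed.
Fact series_addC : commutative series_add.
Proof. by move=> X Y; apply/funext => w; rewrite /series_add addrC. Qed.
Fact series_add0 : left_id series0 series_add.
Proof. by move=> X; apply/funext => w; rewrite /series_add add0r. Qed.
Fact series_addN : left_inverse series0 series_opp series_add.
Proof. by move=> X; apply/funext => w; rewrite /series_add addNr. Qed.

HB.instance Definition _ := Algebra.isZmodule.Build (series K n)
  series_addA series_addC series_add0 series_addN.

Fact series_mulA : associative series_mul.
Proof.
move=> X Y Z; apply/funext => w; rewrite /series_mul /=.
pose G i j := X (FMonom (take i w)) *
  (Y (FMonom (take j (drop i w))) * Z (FMonom (drop (j + i) w))).
transitivity (\sum_(0 <= i < (size w).+1) \sum_(0 <= j < (size w).+1 - i) G i j).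
  rewrite big_mkord; apply: eq_bigr => i _.
  rewrite big_mkord mulr_sumr size_drop subSn -1?ltnS //.
  by apply: eq_bigr => j _; rewrite drop_drop.
transitivity (\sum_(0 <= k < (size w).+1)
                \sum_(0 <= i < (size w).+1 | (i <= k)%N) G i (k - i)%N).
  rewrite (exchange_big_dep_nat xpredT) //=; apply: eq_bigr => i _.
  rewrite -(@big_nat_widenl _ _ _ i 0%N _ xpredT) // [RHS](@big_addn _ _ _ 0 _ i).
  by apply: eq_bigr => j _; rewrite addnK.
rewrite big_mkord; apply: eq_bigr => k _.
have kw : (k <= size w)%N by rewrite -ltnS.
rewrite -(@big_nat_widen _ _ _ 0 k.+1 _ xpredT) // big_mkord size_takel //.
rewrite mulr_suml; apply: eq_bigr => i _.
have ik : (i <= k)%N by rewrite -ltnS.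
by rewrite /G subnK // take_takel // take_drop subnK // mulrA.
Qed.

Fact series_mul1l : left_id series1 series_mul.
Proof.
move=> X; apply/funext => w; rewrite /series_mul /series1 big_ord_recl /=.
rewrite take0 drop0 fmK mul1r big1 ?addr0 // => i _ /=.
by rewrite size_takel ?mul0r.
Qed.

Fact series_mul1r : right_id series1 series_mul.
Proof.
move=> X; apply/funext => w; rewrite /series_mul /series1 big_ord_recr /=.
rewrite take_size drop_size fmK mulr1 big1 ?add0r // => i _ /=.
by rewrite size_drop subn_eq0 leqNgt ltn_ord mulr0.
Qed.

Fact series_mulDl : left_distributive series_mul +%R.
Proof.
move=> X Y Z; apply/funext => w; rewrite -[RHS]big_split.
by apply: eq_bigr => i _; exact: mulrDl.
Qed.

Fact series_mulDr : right_distributive series_mul +%R.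
Proof.
move=> X Y Z; apply/funext => w; rewrite -[RHS]big_split.
by apply: eq_bigr => i _; exact: mulrDr.
Qed.

Fact series1_neq0 : series1 != 0.
Proof.
by apply/eqP => /(congr1 (@^~ (FMonom [::])))/eqP; rewrite oner_eq0.
Qed.

HB.instance Definition _ := GRing.Zmodule_isNzRing.Build (series K n)
  series_mulA series_mul1l series_mul1r series_mulDl series_mulDr series1_neq0.

Fact series_scaleA c d X :
  series_scale c (series_scale d X) = series_scale (c * d) X.
Proof. by apply/funext => w; rewrite /series_scale mulrA. Qed.
Fact series_scale1 : left_id 1 series_scale.
Proof. by move=> X; apply/funext => w; rewrite /series_scale mul1r. Qed.
Fact series_scaleDr : right_distributive series_scale +%R.
Proof. by move=> c X Y; apply/funext => w; exact: mulrDr. Qed.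
Fact series_scaleDl X : {morph series_scale^~ X : c d / c + d}.
Proof. by move=> c d; apply/funext => w; exact: mulrDl. Qed.

HB.instance Definition _ := GRing.Zmodule_isLmodule.Build K (series K n)
  series_scaleA series_scale1 series_scaleDr series_scaleDl.

Fact series_scaleAl c X Y : c *: (X * Y) = c *: X * Y.
Proof.
apply/funext => w; rewrite [LHS]mulr_sumr.
by apply: eq_bigr => i _; rewrite [LHS]mulrA.
Qed.

HB.instance Definition _ := GRing.Lmodule_isLalgebra.Build K (series K n)
  series_scaleAl.

Fact series_scaleAr c X Y : c *: (X * Y) = X * (c *: Y).
Proof.
apply/funext => w; rewrite [LHS]mulr_sumr.
by apply: eq_bigr => i _; rewrite [LHS]mulrCA.
Qed.

HB.instance Definition _ := GRing.Lalgebra_isAlgebra.Build K (series K n)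
  series_scaleAr.

End SeriesAlgebra.

Definition genS (K : fieldType) (n : nat) (i : 'I_n) : series K n :=
  fun w => (w == fmu i)%:R.

Definition hpart (K : fieldType) (n d : nat) (X : series K n) : freealg K n :=
  \sum_(w : d.-tuple 'I_n) << X (FMonom w) *g FMonom w >>.

(* The degree completion of the free Lie algebra. *)
Definition lie_series (K : fieldType) (n : nat) (X : series K n) : Prop :=
  forall d : nat, free_lie (hpart d X).

(* Only meaningful when L has no constant term: then (L ^+ j) w = 0 as soon   *)
(* as j > size w, so that the truncated sum is the full exponential series.   *)
Definition expS (K : fieldType) (n : nat) (L : series K n) : series K n :=
  fun w => \sum_(j < (size w).+1) (j`!%:R)^-1 * (L ^+ j) w.

(* The tensor square of freealg K n is the monoid algebra of the product of   *)
(* two copies of the free monoid, (u, v) standing for the tensor u (x) v.     *)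
Section ProductMonoid.
Variables M N : monomType.
Implicit Types x y z : M * N.

Definition pairm1 : M * N := (mone, mone).
Definition pairm_mul x y : M * N := (mmul x.1 y.1, mmul x.2 y.2).

Fact pairm_mulA : associative pairm_mul.
Proof. by move=> x y z; rewrite /pairm_mul !mulmA. Qed.
Fact pairm_mul1l : left_id pairm1 pairm_mul.
Proof. by case=> x y; rewrite /pairm_mul !mul1m. Qed.
Fact pairm_mul1r : right_id pairm1 pairm_mul.
Proof. by case=> x y; rewrite /pairm_mul !mulm1. Qed.
Fact pairm_unit x y : pairm_mul x y = pairm1 -> x = pairm1 /\ y = pairm1.
Proof. by case: x y => [a b] [c d] [] /unitm[-> ->] /unitm[-> ->]. Qed.

HB.instance Definition _ := Choice_isMonomialDef.Build (M * N)%type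
  pairm_mulA pairm_mul1l pairm_mul1r pairm_unit.
End ProductMonoid.

Notation freealg2 K n := {malg K[({fmonom 'I_n} * {fmonom 'I_n})%type]}.

Definition coprod (K : fieldType) (n : nat) (P : freealg K n) : freealg2 K n :=
  mmap (@malgC ({fmonom 'I_n} * {fmonom 'I_n})%type K)
    (fun w : {fmonom 'I_n} =>
       \prod_(i <- w) (<< (fmu i, mone) >> + << (mone, fmu i) >>)) P.

(* As coprod preserves the total degree, the coefficient of u (x) v only      *)
(* involves the component of X of degree size u + size v.                     *)
Definition coprodS (K : fieldType) (n : nat) (X : series K n)
    (u v : {fmonom 'I_n}) : K :=
  (coprod (hpart (size u + size v) X))@_((u, v)).

Definition group_like (K : fieldType) (n : nat) (X : series K n) : Prop :=
  X mone = 1 /\ forall u v : {fmonom 'I_n}, coprodS X u v = X u * X v.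

(* The inverse of the bijection exp from Lie series to group-like series; the *)
(* value is irrelevant (0) when X is not group-like.                          *)
Definition logS (K : fieldType) (n : nat) (X : series K n) : series K n :=
  xget 0 [set L : series K n | lie_series L /\ expS L = X]%classic.

Definition multilinear_part (K : fieldType) (k : nat) (X : series K k) :
    freealg K k :=
  \sum_(w : k.-tuple 'I_k | [forall i : 'I_k, count_mem i w == 1%N])
    << X (FMonom w) *g FMonom w >>.

Definition CBH (K : fieldType) (k : nat) : freealg K k :=
  multilinear_part (logS (\prod_(i < k) expS (genS K i))).

Definition cbh_monom (K : fieldType) (n : nat) (w : {fmonom 'I_n}) :
    freealg K n :=
  if size w == 0%N then 0
  else evalF (fun j : 'I_(size w) => genF K (tnth (in_tuple w) j))
         (CBH K (size w)).

Definition cbh (K : fieldType) (n : nat) (P : freealg K n) : freealg K n :=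
  mmap (@malgC {fmonom 'I_n} K) (@cbh_monom K n) P.

(* The extension of the degree-preserving map cbh to the completions. *)
Definition cbhS (K : fieldType) (n : nat) (X : series K n) : series K n :=
  fun w => (cbh (hpart (size w) X))@_w.

(* Main.v *)
Require Import Defs.
From mathcomp Require Import all_boot all_algebra.
From mathcomp.multinomials Require Import monalg.
From mathcomp Require Import boolp classical_sets.

Set Implicit Arguments.
Unset Strict Implicit.
Unset Printing Implicit Defensive.

Import GRing.Theory.
Local Open Scope ring_scope.

(** Read a series X as a linear form on words. Then X is group-like exactly
    when this form is a character of the shuffle algebra: the sum of X over the
    shuffles of u and v is X u * X v (group_like_char). Deconcatenation is
    compatible with shuffles (shuffle_cuts), so characters are stable under
    products, and the powers X ^+ t are characters too.

    The logarithm is handled through interpolation. If L has no constant term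
    and expS L = X, then for each word w the coefficient of w in X ^+ t, that
    is, in exp (t L), is the value at t of a polynomial exp_poly L w, whose
    linear coefficient is L w. As the characteristic is 0, an identity between
    the powers of group-like series that holds for every natural exponent is an
    identity between such polynomials, and its linear part is an identity
    between logarithms. This principle is used three times.

    - The logarithm is unique (expS_inj).
    - The identity (X ^+ t) (u sh v) = (X ^+ t) u * (X ^+ t) v shows that L
      vanishes on the shuffles of two nonempty words: L is primitive
      (shuffle_char_log). The Dynkin-Specht-Wever argument (dynkin) then
      shows that the components of L are Lie polynomials. So logS is a genuine
      logarithm on group-like series (logS_spec), in particular on
      bch k = e^{x_1} ... e^{x_k}, which defines CBH.
    - View a word w of length k as a function of the position. Cutting w into t
      pieces and shuffling the pieces gives the words w o r, where r runs over
      a list R_t = deal t (enum 'I_k) of permutations of the positions that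
      depends neither on w nor on X; as X is a character, (X ^+ t) w is the sum
      of X (w o r) over R_t (deal_exp). The same formula holds for bch k at a
      permutation s, and bch k takes the value 1 at the identity and 0 at the
      other permutations (bch_perm), so (bch k ^+ t) s is the multiplicity of
      s^-1 in R_t. Hence
        (X ^+ t) w = \sum_s X (w o s^-1) * (bch k ^+ t) s,
      whose linear part in t is
        (log X) w = \sum_s X (w o s^-1) * (log (bch k)) s   (log_bch).
      The right-hand side is the coefficient of w in cbhS X. *)

(** * Shuffles and deconcatenation of words *)

Section Words.
Variable T : eqType.
Implicit Types (a b : T) (u v w : seq T).

Fixpoint shuffle u : seq T -> seq (seq T) :=
  if u is a :: u' then
    fix shuffle_u v :=
      if v is b :: v' then
        [seq a :: w | w <- shuffle u' v] ++ [seq b :: w | w <- shuffle_u v']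
      else [:: u]
  else fun v => [:: v].

Lemma shuffle0w v : shuffle [::] v = [:: v]. Proof. by []. Qed.
Lemma shufflew0 u : shuffle u [::] = [:: u]. Proof. by case: u. Qed.
Lemma shuffle_cons a u b v :
  shuffle (a :: u) (b :: v) =
  [seq a :: w | w <- shuffle u (b :: v)] ++ [seq b :: w | w <- shuffle (a :: u) v].
Proof. by []. Qed.

Lemma shuffle_ind (P : seq T -> seq T -> Prop) :
    (forall v, P [::] v) -> (forall u, P u [::]) ->
    (forall a u b v, P u (b :: v) -> P (a :: u) v -> P (a :: u) (b :: v)) ->
  forall u v, P u v.
Proof.
move=> P0w Pw0 Pcons; elim=> [//|a u IHu]; elim=> [//|b v IHv].
exact: Pcons.
Qed.

Lemma shuffle_perm u v w : w \in shuffle u v -> perm_eq w (u ++ v).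
Proof.
move: u v w; apply: shuffle_ind => [v w|u w|a u b v IHu IHv w].
- by rewrite inE => /eqP->.
- by rewrite shufflew0 inE cats0 => /eqP->.
rewrite shuffle_cons mem_cat => /orP[] /mapP[x /[swap] -> xin].
  by rewrite /= perm_cons IHu.
rewrite perm_sym -(cat1s b v) perm_catCA /= perm_cons perm_sym; exact: IHv.
Qed.

Lemma size_shuffle u v : size (shuffle u v) = 'C(size u + size v, size u).
Proof.
move: u v; apply: shuffle_ind => [v|u|a u b v IHu IHv].
- by rewrite bin0.
- by rewrite shufflew0 addn0 binn.
rewrite shuffle_cons size_cat !size_map IHu IHv /= [in RHS]addSn binS.
by rewrite [in RHS]addnC addSnnS.
Qed.

Fixpoint cuts w : seq (seq T * seq T) :=
  ([::], w) ::
    (if w is a :: w' then [seq (a :: p.1, p.2) | p <- cuts w'] else [::]).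

Lemma cuts_cons a w :
  cuts (a :: w) = ([::], a :: w) :: [seq (a :: p.1, p.2) | p <- cuts w].
Proof. by []. Qed.

Lemma cutsP p w : p \in cuts w -> p.1 ++ p.2 = w.
Proof.
elim: w p => [|a w IHw] p; first by rewrite inE => /eqP->.
rewrite cuts_cons inE => /orP[/eqP-> //|/mapP[q qin ->]] /=.
by rewrite IHw.
Qed.

(** The terms u (x) v of the coproduct of the word w, for which letters are
    primitive. *)
Fixpoint unshuffle w : seq (seq T * seq T) :=
  if w is a :: w' then
    [seq (a :: p.1, p.2) | p <- unshuffle w'] ++
    [seq (p.1, a :: p.2) | p <- unshuffle w']
  else [:: ([::], [::])].

Lemma size_unshuffle p w : p \in unshuffle w -> (size p.1 + size p.2)%N = size w.
Proof.
elim: w p => [|a w IHw] p /=; first by rewrite inE => /eqP->.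
by rewrite mem_cat => /orP[] /mapP[q qin ->] /=; rewrite ?addnS ?addSn IHw.
Qed.

Lemma count_consl a b u v (s : seq (seq T * seq T)) :
  count_mem (b :: u, v) [seq (a :: p.1, p.2) | p <- s] =
  ((a == b) * count_mem (u, v) s)%N.
Proof.
rewrite count_map; have [<-|ab] := eqVneq a b.
  by rewrite mul1n; apply: eq_count => -[x y]; rewrite /= !xpair_eqE eqseq_cons eqxx.
rewrite mul0n (@eq_count _ _ pred0) ?count_pred0 // => -[x y] /=.
by rewrite xpair_eqE eqseq_cons (negPf ab).
Qed.

Lemma count_consr a b u v (s : seq (seq T * seq T)) :
  count_mem (u, b :: v) [seq (p.1, a :: p.2) | p <- s] =
  ((a == b) * count_mem (u, v) s)%N.
Proof.
rewrite count_map; have [<-|ab] := eqVneq a b.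
  by rewrite mul1n; apply: eq_count => -[x y]; rewrite /= !xpair_eqE eqseq_cons eqxx.
rewrite mul0n (@eq_count _ _ pred0) ?count_pred0 // => -[x y] /=.
by rewrite xpair_eqE eqseq_cons (negPf ab) andbF.
Qed.

Lemma count_cons a b w (s : seq (seq T)) :
  count_mem (b :: w) [seq a :: x | x <- s] = ((a == b) * count_mem w s)%N.
Proof.
rewrite count_map; have [<-|ab] := eqVneq a b.
  by rewrite mul1n; apply: eq_count => x; rewrite /= eqseq_cons eqxx.
rewrite mul0n (@eq_count _ _ pred0) ?count_pred0 // => x /=.
by rewrite eqseq_cons (negPf ab).
Qed.

(** The coproduct is the transpose of the shuffle product. *)
Lemma count_unshuffle u v w :
  count_mem (u, v) (unshuffle w) = count_mem w (shuffle u v).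
Proof.
elim: w u v => [|a w IHw] u v.
  case: u v => [|b u] [|c v] //; apply/esym/count_memPn/negP.
  by move/shuffle_perm; rewrite perm_sym => /perm_size.
have nilP (s : seq (seq T * seq T)) x (f g : seq T * seq T -> seq T) :
    (forall p, (f p, g p) != x) -> count_mem x [seq (f p, g p) | p <- s] = 0%N.
  move=> Nx; apply/count_memPn/negP => /mapP[p _ xE].
  by case/negP: (Nx p); rewrite xE.
have N1 p v' : (a :: p.1, p.2) != ([::], v') :> seq T * seq T by [].
have N2 p u' : (p.1, a :: p.2) != (u', [::]) :> seq T * seq T.
  by rewrite xpair_eqE andbF.
rewrite /= count_cat; case: u v => [|b u] [|c v].
- by rewrite !nilP ?shuffle0w //= .
- by rewrite nilP // count_consr IHw !shuffle0w /= !addn0 eqseq_cons mulnb [a == _]eq_sym.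
- by rewrite count_consl nilP // IHw !shufflew0 /= !addn0 eqseq_cons mulnb [a == _]eq_sym.
- by rewrite count_consl count_consr !IHw shuffle_cons count_cat !count_cons ![a == _]eq_sym.
Qed.

(** The terms of the j-th convolution power of the identity of the shuffle
    algebra: w is cut into j consecutive, possibly empty, pieces, which are then
    shuffled together. This is a riffle shuffle of a deck dealt into j piles. *)
Fixpoint deal j w : seq (seq T) :=
  if j is j'.+1 then
    flatten [seq flatten [seq shuffle p.1 v | v <- deal j' p.2] | p <- cuts w]
  else if w is [::] then [:: [::]] else [::].

Lemma deal_perm j w v : v \in deal j w -> perm_eq v w.
Proof.
elim: j w v => [|j IHj] w v /=; first by case: w => //; rewrite inE => /eqP->.
case/flatten_mapP=> p /cutsP <- /flatten_mapP[x /IHj xp /shuffle_perm vp].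
by rewrite (perm_trans vp) // perm_cat2l.
Qed.

End Words.

Arguments shuffle : simpl never.
Arguments cuts : simpl never.

Section Naturality.
Variables (T S : eqType) (f : T -> S).

Lemma map_shuffle (u v : seq T) :
  shuffle (map f u) (map f v) = map (map f) (shuffle u v).
Proof.
move: u v; apply: shuffle_ind => [//|u|a u b v IHu IHv]; first by rewrite !shufflew0.
rewrite !map_cons !shuffle_cons -!map_cons IHu IHv map_cat.
by congr (_ ++ _); rewrite -!map_comp.
Qed.

Lemma map_cuts (w : seq T) :
  cuts (map f w) = [seq (map f p.1, map f p.2) | p <- cuts w].
Proof.
elim: w => [//|a w IHw]; rewrite map_cons !cuts_cons IHw map_cons.
by congr (_ :: _); rewrite -!map_comp.
Qed.

Lemma map_deal j (w : seq T) : deal j (map f w) = map (map f) (deal j w).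
Proof.
elim: j w => [|j IHj] w /=; first by case: w.
rewrite map_cuts map_flatten -!map_comp; congr flatten; apply: eq_map => p /=.
rewrite IHj map_flatten -!map_comp; congr flatten; apply: eq_map => v /=.
exact: map_shuffle.
Qed.
End Naturality.

Section ShuffleCuts.
Variables (T : eqType) (V : nmodType).

Lemma big_cuts_cons (F : seq T * seq T -> V) a w :
  \sum_(p <- cuts (a :: w)) F p =
  F ([::], a :: w) + \sum_(p <- cuts w) F (a :: p.1, p.2).
Proof. by rewrite cuts_cons big_cons big_map. Qed.

(** The bialgebra axiom: to cut a shuffle of u and v is to cut u and v and to
    shuffle the left parts together and the right parts together. Here it is
    tested against an arbitrary function F of the two parts. *)
Lemma shuffle_cuts (F : seq T -> seq T -> V) (u v : seq T) :
  \sum_(w <- shuffle u v) \sum_(p <- cuts w) F p.1 p.2 =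
  \sum_(p <- cuts u) \sum_(q <- cuts v)
    \sum_(x <- shuffle p.1 q.1) \sum_(y <- shuffle p.2 q.2) F x y.
Proof.
move: u v F; apply: shuffle_ind => [v F|u F|a u b v IHu IHv F].
- rewrite !big_seq1; apply: eq_bigr => q _.
  by rewrite !shuffle0w !big_seq1.
- rewrite shufflew0 big_seq1; apply: eq_bigr => q _.
  by rewrite big_seq1 !shufflew0 !big_seq1.
rewrite shuffle_cons big_cat /= !big_map.
under eq_bigr do rewrite cuts_cons big_cons big_map /=.
rewrite big_split /= (IHu (fun x y => F (a :: x) y)).
under [X in _ + X]eq_bigr do rewrite cuts_cons big_cons big_map /=.
rewrite big_split /= (IHv (fun x y => F (b :: x) y)).
rewrite addrACA -(big_map (cons a) xpredT (F [::])).
rewrite -(big_map (cons b) xpredT (F [::])) -big_cat -shuffle_cons.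
have E1 : \sum_(q <- cuts (b :: v)) \sum_(x <- shuffle [::] q.1)
      \sum_(y <- shuffle (a :: u) q.2) F x y =
    \sum_(y <- shuffle (a :: u) (b :: v)) F [::] y +
    \sum_(q <- cuts v) \sum_(x <- shuffle [::] q.1)
      \sum_(y <- shuffle (a :: u) q.2) F (b :: x) y.
  rewrite cuts_cons big_cons big_map big_seq1; congr (_ + _).
  by apply: eq_bigr => q _; rewrite !shuffle0w !big_seq1.
have E2 p : \sum_(q <- cuts (b :: v)) \sum_(x <- shuffle (a :: p.1) q.1)
      \sum_(y <- shuffle p.2 q.2) F x y =
    \sum_(q <- cuts (b :: v)) \sum_(x <- shuffle p.1 q.1)
      \sum_(y <- shuffle p.2 q.2) F (a :: x) y +
    \sum_(q <- cuts v) \sum_(x <- shuffle (a :: p.1) q.1)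
      \sum_(y <- shuffle p.2 q.2) F (b :: x) y.
  rewrite cuts_cons !big_cons !big_map !shufflew0 !big_cons !big_nil !addr0.
  rewrite -[RHS]addrA; congr (_ + _).
  rewrite -big_split; apply: eq_bigr => q _ /=.
  by rewrite shuffle_cons big_cat !big_map.
rewrite !(big_cuts_cons _ a u) /= E1 -addrA; congr (_ + _).
rewrite addrCA; congr (_ + _); rewrite -big_split; apply: eq_bigr => p _ /=.
by rewrite E2.
Qed.
End ShuffleCuts.

(** * Characters of the shuffle algebra *)

Section Series.
Variables (K : fieldType) (n : nat).
Implicit Types (X Y L : series K n) (u v w : seq 'I_n).

Lemma mone_FMonom : mone = FMonom [::] :> {fmonom 'I_n}.
Proof. exact: fmoneE. Qed.

Lemma series_ext X Y : (forall w, X (FMonom w) = Y (FMonom w)) -> X = Y.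
Proof. by move=> XY; apply/funext => -[w]. Qed.

Lemma series_addE X Y (m : {fmonom 'I_n}) : (X + Y) m = X m + Y m. Proof. by []. Qed.
Lemma series_oppE X (m : {fmonom 'I_n}) : (- X) m = - X m. Proof. by []. Qed.
Lemma series_scaleE c X (m : {fmonom 'I_n}) : (c *: X) m = c * X m. Proof. by []. Qed.
Lemma series_oneE w : (1 : series K n) (FMonom w) = (w == [::])%:R.
Proof. by rewrite -[LHS]/((size w == 0%N)%:R) size_eq0. Qed.

Lemma series_sumE I (r : seq I) (P : pred I) (F : I -> series K n)
    (m : {fmonom 'I_n}) :
  (\sum_(i <- r | P i) F i) m = \sum_(i <- r | P i) F i m.
Proof. exact: (big_morph (fun X : series K n => X m)). Qed.

Lemma sum_takedrop (F : seq 'I_n -> seq 'I_n -> K) w :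
  \sum_(i < (size w).+1) F (take i w) (drop i w) =
  \sum_(p <- cuts w) F p.1 p.2.
Proof.
elim: w F => [|a w IHw] F; first by rewrite big_ord1 big_seq1.
by rewrite big_ord_recl big_cuts_cons -(IHw (fun x y => F (a :: x) y)).
Qed.

Lemma series_mulE X Y w :
  (X * Y) (FMonom w) = \sum_(p <- cuts w) X (FMonom p.1) * Y (FMonom p.2).
Proof. exact: (sum_takedrop (fun x y => X (FMonom x) * Y (FMonom y))). Qed.

Lemma series_mul_nil X Y :
  (X * Y) (FMonom [::]) = X (FMonom [::]) * Y (FMonom [::]).
Proof. by rewrite series_mulE big_seq1. Qed.

Lemma series_exp_nil X j : (X ^+ j) (FMonom [::]) = X (FMonom [::]) ^+ j.
Proof.
elim: j => [|j IHj]; first by rewrite !expr0 series_oneE.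
by rewrite !exprS series_mul_nil IHj.
Qed.

Lemma series_mul_small X Y i j w :
    (forall u, (size u < i)%N -> X (FMonom u) = 0) ->
    (forall u, (size u < j)%N -> Y (FMonom u) = 0) ->
  (size w < i + j)%N -> (X * Y) (FMonom w) = 0.
Proof.
move=> X0 Y0 wij; rewrite series_mulE big_seq big1 // => p /cutsP pw.
have [/X0->|ip] := ltnP (size p.1) i; first by rewrite mul0r.
rewrite Y0 ?mulr0 // -(ltn_add2l i) (leq_trans _ wij) //.
by rewrite ltnS -pw size_cat leq_add2r.
Qed.

Lemma series_exp_small L j w :
  L (FMonom [::]) = 0 -> (size w < j)%N -> (L ^+ j) (FMonom w) = 0.
Proof.
move=> L0; elim: j w => [//|j IHj] w wj.
by rewrite exprS (@series_mul_small _ _ 1%N j) // => -[].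
Qed.

Lemma expS_wide L N w : L (FMonom [::]) = 0 -> (size w < N)%N ->
  expS L (FMonom w) = \sum_(j < N) (j`!%:R)^-1 * (L ^+ j) (FMonom w).
Proof.
move=> L0 wN; rewrite /expS (big_ord_widen N (fun j => (j`!%:R)^-1 * (L ^+ j) (FMonom w))) //.
rewrite big_mkcond; apply: eq_bigr => j _; case: ltnP => // wj.
by rewrite series_exp_small ?mulr0.
Qed.

Lemma expS_nil L : expS L (FMonom [::]) = 1.
Proof. by rewrite /expS big_ord1 expr0 fact0 invr1 mul1r series_oneE. Qed.

Definition shuffle_char X : Prop :=
  X (FMonom [::]) = 1 /\
  forall u v, \sum_(w <- shuffle u v) X (FMonom w) = X (FMonom u) * X (FMonom v).

Lemma shuffle_char1 : shuffle_char 1.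
Proof.
split=> [|u v]; first by rewrite series_oneE.
case: u => [|a u]; first by rewrite big_seq1 !series_oneE mul1r.
case: v => [|b v]; first by rewrite shufflew0 big_seq1 !series_oneE mulr1.
rewrite [in RHS]series_oneE mul0r big_seq big1 // => w /shuffle_perm/perm_size.
by rewrite series_oneE; case: w.
Qed.

(** Product of series and shuffle product are dual to the two halves of a
    bialgebra, so characters form a monoid. *)
Lemma shuffle_charM X Y : shuffle_char X -> shuffle_char Y -> shuffle_char (X * Y).
Proof.
move=> [X1 XM] [Y1 YM]; split=> [|u v]; first by rewrite series_mul_nil X1 Y1 mulr1.
under eq_bigr do rewrite series_mulE.
rewrite (shuffle_cuts (fun x y => X (FMonom x) * Y (FMonom y))) !series_mulE.
rewrite mulr_suml; apply: eq_bigr => p _; rewrite mulr_sumr; apply: eq_bigr => q _.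
rewrite mulrACA -XM -YM mulr_suml; apply: eq_bigr => x _.
by rewrite mulr_sumr.
Qed.

Lemma shuffle_charX X t : shuffle_char X -> shuffle_char (X ^+ t).
Proof.
move=> charX; elim: t => [|t IHt]; first exact: shuffle_char1.
by rewrite exprS; exact: shuffle_charM.
Qed.

(** Each product of values of X on the pieces of w is a sum of values of X on
    shuffles of the pieces. *)
Lemma deal_exp X j w : shuffle_char X ->
  (X ^+ j) (FMonom w) = \sum_(v <- deal j w) X (FMonom v).
Proof.
move=> [X1 XM]; elim: j w => [|j IHj] w /=.
  by rewrite expr0 series_oneE; case: w => [|a w]; rewrite ?big_nil ?big_seq1 ?X1.
rewrite exprS series_mulE big_flatten big_map; apply: eq_bigr => p _.
rewrite IHj mulr_sumr big_flatten big_map; apply: eq_bigr => v _.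
by rewrite XM.
Qed.

End Series.

Section Char0.
Variables (K : fieldType) (char0 : [pchar K] =i pred0).
Lemma natr_eq0 m : ((m%:R : K) == 0) = (m == 0%N).
Proof. exact: (pcharf0P K).1. Qed.

Lemma natrS_neq0 m : (m.+1%:R : K) != 0.
Proof. by rewrite natr_eq0. Qed.

(** A nonzero polynomial has finitely many roots, while the natural numbers are
    pairwise distinct in K. *)
Lemma poly_eq_nat (p q : {poly K}) : (forall t : nat, p.[t%:R] = q.[t%:R]) -> p = q.
Proof.
move=> pq; apply/eqP; rewrite -subr_eq0; apply/eqP.
apply: (@roots_geq_poly_eq0 _ _ [seq t%:R | t <- iota 0 (size (p - q))]).
- by apply/allP => _ /mapP[t _ ->]; rewrite /root hornerD hornerN pq subrr.
- rewrite map_inj_uniq ?iota_uniq // => x y.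
  wlog xy : x y / (x <= y)%N => [th exy|exy].
    by have [/th->|/ltnW/th->] := leqP x y.
  apply/eqP; rewrite eqn_leq xy -subn_eq0 -natr_eq0 natrB // exy subrr.
  exact: eqxx.
- by rewrite size_map size_iota.
Qed.
End Char0.

(** * Exponential and logarithm of series *)

Section ExpLog.
Variables (K : fieldType) (char0 : [pchar K] =i pred0) (n : nat).
Implicit Types (X Y L : series K n) (u v w : seq 'I_n).

Lemma sum_triangle (N : nat) (G : nat -> nat -> K) :
    (forall i j, (N <= i + j)%N -> G i j = 0) ->
  \sum_(i < N) \sum_(j < N) G i j = \sum_(m < N) \sum_(i < m.+1) G (m - i)%N i.
Proof.
move=> G0; rewrite exchange_big /=.
transitivity (\sum_(0 <= j < N) \sum_(0 <= m < N | (j <= m)%N) G (m - j)%N j).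
  rewrite big_mkord; apply: eq_bigr => j _.
  rewrite -(@big_nat_widenl _ _ _ j 0%N _ xpredT) // (@big_addn _ _ _ 0 _ j).
  rewrite -(big_mkord xpredT (G^~ j)) [LHS](@big_cat_nat _ _ _ (N - j)%N) ?leq_subr //=.
  rewrite [X in _ + X]big_nat [X in _ + X]big1 ?addr0 => [|i /andP[ij _]].
    by apply: eq_bigr => i _; rewrite addnK.
  by rewrite G0 // addnC -leq_subLR.
rewrite (exchange_big_dep_nat xpredT) //= big_mkord; apply: eq_bigr => m _.
by rewrite -(@big_nat_widen _ _ _ 0 m.+1 _ xpredT) // big_mkord.
Qed.

(** Both sides are the sum of A ^+ i * B ^+ j / (i! j!): on the right by
    definition, on the left by the binomial formula. The truncation at
    i, j <= size w is harmless since A ^+ i * B ^+ j has no term of degree less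
    than i + j. *)
Lemma expS_add (A B : series K n) : A (FMonom [::]) = 0 -> B (FMonom [::]) = 0 ->
  GRing.comm A B -> expS (A + B) = expS A * expS B.
Proof.
move=> A0 B0 cAB; apply: series_ext => w; set N := (size w).+1.
have AB0 : (A + B) (FMonom [::]) = 0 by rewrite series_addE A0 B0 addr0.
pose G i j := (i`!%:R)^-1 * (j`!%:R)^-1 * (A ^+ i * B ^+ j) (FMonom w).
transitivity (\sum_(i < N) \sum_(j < N) G i j); last first.
  rewrite series_mulE /G.
  under eq_bigr do under eq_bigr do rewrite series_mulE mulr_sumr.
  under eq_bigr do rewrite exchange_big /=.
  rewrite exchange_big /= big_seq [RHS]big_seq; apply: eq_bigr => p /cutsP pw.
  have pN : (size p.1 < N)%N /\ (size p.2 < N)%N.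
    by rewrite /N -pw size_cat !ltnS leq_addr leq_addl.
  rewrite (expS_wide A0 pN.1) (expS_wide B0 pN.2) mulr_suml; apply: eq_bigr => i _.
  by rewrite mulr_sumr; apply: eq_bigr => j _; rewrite mulrACA.
rewrite sum_triangle => [|i j ij]; last first.
  rewrite /G (@series_mul_small _ _ _ _ i j) ?mulr0 // => u.
    exact: series_exp_small.
  exact: series_exp_small.
rewrite (@expS_wide _ _ _ N) //; apply: eq_bigr => m _.
rewrite (exprDn_comm _ cAB) series_sumE mulr_sumr; apply: eq_bigr => i _.
have im : (i <= m)%N by rewrite -ltnS.
rewrite /G -[X in X (FMonom w)]scaler_nat series_scaleE mulrA; congr (_ * _).
have /(congr1 (fun k => k%:R : K)) := bin_fact im.
rewrite !natrM => mE; rewrite -mE !invfM.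
have b0 : 'C(m, i)%:R != 0 :> K.
  by rewrite natr_eq0 // -lt0n bin_gt0.
by rewrite mulrAC mulVf // mul1r mulrC.
Qed.

(** The coefficient of the word w in exp (T L), as a polynomial in T. *)
Definition exp_poly L w : {poly K} :=
  \poly_(j < (size w).+1) ((j`!%:R)^-1 * (L ^+ j) (FMonom w)).

Lemma horner_exp_poly L w c : (exp_poly L w).[c] = expS (c *: L) (FMonom w).
Proof.
rewrite horner_poly /expS; apply: eq_bigr => j _.
by rewrite exprZn series_scaleE mulrAC mulrA.
Qed.

Lemma expS_mulrn L t : L (FMonom [::]) = 0 -> expS (L *+ t) = expS L ^+ t.
Proof.
move=> L0; elim: t => [|t IHt].
  rewrite mulr0n expr0; apply: series_ext => w.
  rewrite /expS big_ord_recl expr0 fact0 invr1 mul1r big1 ?addr0 // => j _.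
  by rewrite expr0n mulr0.
have Lt0 : (L *+ t) (FMonom [::]) = 0.
  by rewrite -scaler_nat series_scaleE L0 mulr0.
by rewrite mulrS exprS -IHt expS_add //; apply: commrMn.
Qed.

Lemma exp_poly_nat L w t : L (FMonom [::]) = 0 ->
  (exp_poly L w).[t%:R] = (expS L ^+ t) (FMonom w).
Proof. by move=> L0; rewrite horner_exp_poly scaler_nat expS_mulrn. Qed.

Lemma exp_poly_coef0 L w : (exp_poly L w)`_0 = (w == [::])%:R.
Proof. by rewrite coef_poly /= fact0 invr1 mul1r expr0 series_oneE. Qed.

Lemma exp_poly_coef1 L w : L (FMonom [::]) = 0 -> (exp_poly L w)`_1 = L (FMonom w).
Proof.
move=> L0; rewrite coef_poly; case: w => [|a w] //=.
by rewrite invr1 mul1r expr1.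
Qed.

(** The powers of expS L determine the polynomials exp_poly L w, hence L. *)
Lemma expS_inj L L' : L (FMonom [::]) = 0 -> L' (FMonom [::]) = 0 ->
  expS L = expS L' -> L = L'.
Proof.
move=> L0 L'0 EL; apply: series_ext => w.
have pE : exp_poly L w = exp_poly L' w.
  by apply: (poly_eq_nat char0) => t; rewrite !exp_poly_nat // EL.
by rewrite -(exp_poly_coef1 w L0) -(exp_poly_coef1 w L'0) pE.
Qed.

(** The logarithm of a character is primitive. Compare the linear parts in t of
    the character identity for X ^+ t: on the right, exp_poly L u and
    exp_poly L v have no constant term, so their product has no linear part. *)
Lemma shuffle_char_log X L : L (FMonom [::]) = 0 -> expS L = X -> shuffle_char X ->
  forall u v, u != [::] -> v != [::] -> \sum_(w <- shuffle u v) L (FMonom w) = 0.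
Proof.
move=> L0 EL charX u v u0 v0.
have pE : \sum_(w <- shuffle u v) exp_poly L w = exp_poly L u * exp_poly L v.
  apply: (poly_eq_nat char0) => t; rewrite horner_sum hornerM.
  under eq_bigr do rewrite exp_poly_nat //.
  by rewrite !exp_poly_nat // EL (shuffle_charX t charX).2.
have /(congr1 (fun p : {poly K} => p`_1)) := pE.
rewrite coef_sum coefM !big_ord_recl big_ord0 /= !exp_poly_coef0.
rewrite (negPf u0) (negPf v0) mul0r mulr0 !addr0 => E0; rewrite -[RHS]E0.
by apply: eq_bigr => w _; rewrite exp_poly_coef1.
Qed.

Definition agree d X Y := forall w, (size w < d)%N -> X (FMonom w) = Y (FMonom w).

Lemma agree_mul d X X' Y Y' : agree d X X' -> agree d Y Y' -> agree d (X * Y) (X' * Y').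
Proof.
move=> XX YY w wd; rewrite !series_mulE big_seq [RHS]big_seq.
apply: eq_bigr => p /cutsP pw.
by rewrite XX ?YY // (leq_ltn_trans _ wd) // -pw size_cat ?leq_addr ?leq_addl.
Qed.

Lemma agree_exp d X X' j : agree d X X' -> agree d (X ^+ j) (X' ^+ j).
Proof.
move=> XX; elim: j => [|j IHj]; first by rewrite !expr0.
by rewrite !exprS; apply: agree_mul.
Qed.

(** Without constant terms, a factor of a product in degree d has degree less
    than d, so agreement up to degree d - 1 of the factors is enough. This gain
    of one degree makes log_step contracting. *)
Lemma agree_mul0 d X X' Y Y' :
    X (FMonom [::]) = 0 -> X' (FMonom [::]) = 0 ->
    Y (FMonom [::]) = 0 -> Y' (FMonom [::]) = 0 ->
  agree d X X' -> agree d Y Y' -> agree d.+1 (X * Y) (X' * Y').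
Proof.
move=> X0 X'0 Y0 Y'0 XX YY w wd; rewrite !series_mulE big_seq [RHS]big_seq.
apply: eq_bigr => -[[|a x] [|b y]] /cutsP pw;
  rewrite ?X0 ?X'0 ?mul0r ?Y0 ?Y'0 ?mulr0 //.
move: wd; rewrite -pw !ltnS size_cat /= !addSn !addnS => wd.
by rewrite XX ?YY //= (leq_trans _ wd) // !ltnS ?leq_addr ?leq_addl.
Qed.

(** The solutions of expS L = X are the fixed points of this map, which is a
    contraction for the degree filtration because expS L - L involves only the
    constant 1 and the powers L ^+ j with j >= 2. *)
Definition log_step X L := L + (X - expS L).

Lemma log_step_nil X L : X (FMonom [::]) = 1 -> L (FMonom [::]) = 0 ->
  log_step X L (FMonom [::]) = 0.
Proof.
move=> X1 L0; rewrite /log_step.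
by rewrite !series_addE series_oppE expS_nil X1 L0 subrr addr0.
Qed.

Lemma agree_log_step X d L L' : X (FMonom [::]) = 1 ->
    L (FMonom [::]) = 0 -> L' (FMonom [::]) = 0 ->
  agree d L L' -> agree d.+1 (log_step X L) (log_step X L').
Proof.
move=> X1 L0 L'0 LL w wd; rewrite /log_step !series_addE !series_oppE /expS.
case: w wd => [|a w] wd; first by rewrite !big_ord1 !expr0 L0 L'0.
rewrite !big_ord_recl /= !expr0 !expr1 !invr1 !mul1r.
rewrite addrCA [RHS]addrCA; congr (_ + _).
rewrite !opprD addrCA [RHS]addrCA; congr (_ + _).
rewrite !addrA !subrr !add0r; congr (- _); apply: eq_bigr => j _.
congr (_ * _); rewrite /bump /= !add1n [L ^+ _]exprS [L' ^+ _]exprS.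
apply: agree_mul0 wd => //; try by rewrite series_exp_nil ?L0 ?L'0 expr0n.
exact: agree_exp.
Qed.

Lemma log_exists X : X (FMonom [::]) = 1 ->
  exists2 L, L (FMonom [::]) = 0 & expS L = X.
Proof.
move=> X1; pose A d := iter d (log_step X) 0.
have A0 d : A d (FMonom [::]) = 0.
  by elim: d => [//|d IHd]; apply: log_step_nil.
have agA d e : agree d (A d) (A (d + e)%N).
  elim: d => [//|d IHd]; rewrite addSn; apply: agree_log_step => //.
(* The iterates stabilise in degree d from the (d + 1)-st on. *)
pose L : series K n := fun m => A (size m).+1 m.
have agL d : agree d (A d) L.
  move=> w wd; rewrite /L -(subnKC wd); symmetry; exact: agA.
have L0 : L (FMonom [::]) = 0 by exact: A0.
exists L => //; apply: series_ext => w.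
have := @agree_log_step X (size w).+1 _ _ X1 (A0 _) L0 (agL _) w (leqnSn _).
rewrite -[log_step X (A _)]/(A (size w).+2) agL // /log_step series_addE => /eqP.
rewrite -subr_eq0 opprD addNKr oppr_eq0 series_addE series_oppE subr_eq0.
by move/eqP.
Qed.

End ExpLog.

(** * Group-like series and Lie polynomials *)

Lemma sum_count (T : eqType) (V : nmodType) (F : T -> V) (r s : seq T) :
  uniq r -> {subset s <= r} ->
  \sum_(x <- s) F x = \sum_(x <- r) F x *+ count_mem x s.
Proof.
move=> r_uniq; elim: s => [_|x s IHs sr].
  by rewrite big_nil big1.
have xr : x \in r by rewrite sr ?mem_head.
rewrite big_cons IHs => [|y ys]; last by rewrite sr // inE ys orbT.
under [RHS]eq_bigr do rewrite /= mulrnDr.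
rewrite big_split /=; congr (_ + _).
rewrite (bigD1_seq x) //= eqxx mulr1n big1 ?addr0 // => y yx.
by rewrite eq_sym (negPf yx).
Qed.

Lemma sum_count1 (R : pzSemiRingType) (T : eqType) (x : T) (s : seq T) :
  \sum_(y <- s) (y == x)%:R = (count_mem x s)%:R :> R.
Proof. by elim: s => [|y s IHs]; rewrite ?big_nil // big_cons IHs /= natrD. Qed.

Section FreeAlgebra.
Variables (K : fieldType) (n : nat).
Implicit Types (X L : series K n) (u v w : seq 'I_n) (P Q : freealg K n).

Definition monom w : freealg K n := << FMonom w >>.

Lemma monalgUZ (M : monomType) (c : K) (k : M) : << c *g k >> = c *: << k >>.
Proof. by apply/malgP => x; rewrite mcoeffZ !mcoeffU mulr_natr. Qed.

Lemma mmapC_sum (M N : monomType) (h : M -> {malg K[N]}) (I : Type)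
    (r : seq I) (P : pred I) (F : I -> {malg K[M]}) :
  mmap (@malgC N K) h (\sum_(i <- r | P i) F i) =
  \sum_(i <- r | P i) mmap (@malgC N K) h (F i).
Proof. exact: raddf_sum. Qed.

Lemma monalgMU (M : monomType) (k l : M) :
  << k >> * << l >> = << mmul k l >> :> {malg K[M]}.
Proof. by rewrite malgM_def fgmulUU mulr1. Qed.

Lemma mmul_FMonom u v : mmul (FMonom u) (FMonom v) = FMonom (u ++ v).
Proof. exact: fmmulE. Qed.

Lemma monom_nil : monom [::] = 1.
Proof. by rewrite /monom -mone_FMonom. Qed.

Lemma monom_cons i w : monom (i :: w) = genF K i * monom w.
Proof. by rewrite /monom /genF monalgMU fmuE mmul_FMonom. Qed.

Definition words d : seq (seq 'I_n) := map val (enum {: d.-tuple 'I_n}).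

Lemma words_uniq d : uniq (words d).
Proof. by rewrite map_inj_uniq ?enum_uniq //; apply: val_inj. Qed.

Lemma mem_words d w : (w \in words d) = (size w == d).
Proof.
apply/mapP/eqP => [[x _ ->]|/eqP wd]; first exact: size_tuple.
by exists (Tuple wd); rewrite ?mem_enum.
Qed.

Lemma sum_words (V : nmodType) (F : seq 'I_n -> V) d :
  \sum_(w : d.-tuple 'I_n) F w = \sum_(w <- words d) F w.
Proof. by rewrite big_map big_enum. Qed.

Lemma hpartE d X : hpart d X = \sum_(w <- words d) X (FMonom w) *: monom w.
Proof.
rewrite -(sum_words (fun w => X (FMonom w) *: monom w)).
by apply: eq_bigr => w _; rewrite monalgUZ.
Qed.

(** A sum over the words that have u (x) v in their coproduct, with
    multiplicities, is a sum over the shuffles of u and v. *)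
Lemma sum_words_shuffle (V : nmodType) (F : seq 'I_n -> V) u v :
  \sum_(w <- words (size u + size v)) F w *+ count_mem (u, v) (unshuffle w) =
  \sum_(w <- shuffle u v) F w.
Proof.
under eq_bigr do rewrite count_unshuffle.
rewrite -(@sum_count _ _ F) ?words_uniq // => w /shuffle_perm/perm_size.
by rewrite mem_words size_cat => ->.
Qed.

Lemma coprod_monom w :
  \prod_(i <- w) (<< (fmu i, mone) >> + << (mone, fmu i) >>) =
  \sum_(p <- unshuffle w) << (FMonom p.1, FMonom p.2) >> :> freealg2 K n.
Proof.
elim: w => [|a w IHw].
  by rewrite big_nil big_seq1 /= -mone_FMonom.
rewrite big_cons IHw mulrDl !mulr_sumr /= big_cat /= !big_map.
congr (_ + _); apply: eq_bigr => p _; rewrite monalgMU; congr << _ >>;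
  by rewrite -[LHS]/(mmul _ _, mmul _ _) /= mul1m fmuE mmul_FMonom.
Qed.

Lemma coprodSE X u v :
  coprodS X (FMonom u) (FMonom v) = \sum_(w <- shuffle u v) X (FMonom w).
Proof.
rewrite /coprodS /coprod /hpart mmapC_sum raddf_sum /=.
rewrite -sum_words_shuffle -sum_words; apply: eq_bigr => w _.
rewrite mmapU /= mcoeffCM coprod_monom raddf_sum /= -mulr_natr; congr (_ * _).
rewrite -sum_count1; apply: eq_bigr => -[x y] _ /=.
by rewrite mcoeffU1 !xpair_eqE.
Qed.

Lemma group_like_char X : group_like X -> shuffle_char X.
Proof.
case=> X1 XM; split=> [|u v]; first by rewrite -mone_FMonom.
by rewrite -coprodSE XM.
Qed.

(** Dynkin's right-normed bracketing [i_1, [i_2, ..., [i_(k-1), i_k]]]. *)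
Fixpoint rbracket w : freealg K n :=
  match w with
  | [::] => 0
  | [:: i] => genF K i
  | i :: w' => genF K i * rbracket w' - rbracket w' * genF K i
  end.

(** As rbracket [::] = 0, the correction term accounts for the words of length
    1, where the bracket formula would give 0. *)
Lemma rbracket_cons i w :
  rbracket (i :: w) =
  genF K i * rbracket w - rbracket w * genF K i + genF K i *+ (w == [::]).
Proof.
case: w => [|j w]; last by rewrite addr0.
by rewrite /= mulr0 mul0r subrr add0r.
Qed.

Arguments rbracket : simpl never.

Lemma free_lie_rbracket w : free_lie (rbracket w).
Proof.
elim: w => [|i [|j w] IHw]; [exact: free_lie_zero|exact: free_lie_gen|].
apply: free_lie_bracket => //; exact: free_lie_gen.
Qed.

Lemma unshuffle_nil (V : nmodType) (F : seq 'I_n -> V) w :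
  \sum_(p <- unshuffle w) F p.2 *+ (p.1 == [::]) = F w.
Proof.
elim: w F => [|a w IHw] F; first by rewrite big_seq1.
rewrite big_cat /= !big_map big1 ?add0r => [|p _]; last by [].
exact: (IHw (fun x => F (a :: x))).
Qed.

(** The convolution of Dynkin's map with the identity is the degree map. In the
    induction, the first letter a goes either to the left part x, giving
    [a, rbracket x] * y, or to the right part, giving rbracket x * a * y. The
    terms rbracket x * a * y cancel. *)
Lemma sum_rbracket_unshuffle w :
  \sum_(p <- unshuffle w) rbracket p.1 * monom p.2 = monom w *+ size w.
Proof.
elim: w => [|a w IHw]; first by rewrite big_seq1 [LHS]mul0r.
rewrite big_cat /= !big_map -big_split /=.
transitivity (\sum_(p <- unshuffle w) (genF K a * (rbracket p.1 * monom p.2)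
    + genF K a * (monom p.2 *+ (p.1 == [::])))).
  apply: eq_bigr => p _; rewrite rbracket_cons monom_cons !mulrDl mulNr -!mulrA.
  rewrite addrAC subrK.
  by congr (_ + _); rewrite mulrnAl mulrnAr.
rewrite big_split /= -!mulr_sumr IHw unshuffle_nil.
by rewrite mulrnAr -monom_cons mulrSr.
Qed.

Lemma free_lie_sum (I : Type) (r : seq I) (P : pred I) (F : I -> freealg K n) :
  (forall i, P i -> free_lie (F i)) -> free_lie (\sum_(i <- r | P i) F i).
Proof.
move=> FP; elim/big_ind: _ => //; [exact: free_lie_zero|exact: free_lie_add].
Qed.

Lemma free_lie_mone P : free_lie P -> P@_mone = 0.
Proof.
elim=> [i||Q R _ Q0 _ R0|c Q _ Q0|Q R _ Q0 _ R0].
- by rewrite /genF mcoeffU1 fmuE mone_FMonom.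
- by rewrite mcoeff0.
- by rewrite mcoeffD Q0 R0 addr0.
- by rewrite mcoeffZ Q0 mulr0.
- by rewrite mcoeffB !rmorphM /= Q0 R0 subrr.
Qed.

Lemma mcoeff_hpart d X w :
  (hpart d X)@_(FMonom w) = X (FMonom w) *+ (size w == d).
Proof.
rewrite hpartE raddf_sum /=.
under eq_bigr do rewrite mcoeffZ mcoeffU1 mulr_natr fmP /=.
have [wd|wd] := eqVneq (size w) d.
  rewrite (bigD1_seq w) ?words_uniq ?mem_words ?wd //= eqxx big1 ?addr0 // => x.
  by move/negPf->.
rewrite big_seq big1 // => x; rewrite mem_words => /eqP xd.
by case: eqP => // xw; rewrite -xw xd eqxx in wd.
Qed.

Lemma lie_series_nil L : lie_series L -> L (FMonom [::]) = 0.
Proof.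
move=> lieL; have := free_lie_mone (lieL 0%N).
by rewrite mone_FMonom mcoeff_hpart.
Qed.

(** Dynkin-Specht-Wever: apply sum_rbracket_unshuffle to the component of
    degree d of L. As L is primitive, only the terms u (x) 1 and 1 (x) v of its
    coproduct survive, and rbracket kills the latter, so that d times the
    component is its image by rbracket, a Lie polynomial. *)
Lemma dynkin (char0 : [pchar K] =i pred0) L : L (FMonom [::]) = 0 ->
    (forall u v, u != [::] -> v != [::] ->
       \sum_(w <- shuffle u v) L (FMonom w) = 0) ->
  lie_series L.
Proof.
move=> L0 primL [|d].
  by rewrite hpartE big_map big1 => [|w _]; [exact: free_lie_zero|rewrite tuple0 L0 scale0r].
(* All the pairs (u, v) with size u + size v = d.+1, listed once. *)
pose r := undup (flatten [seq unshuffle w | w <- words d.+1]).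
have r_uniq : uniq r by exact: undup_uniq.
have r_size p : p \in r -> (size p.1 + size p.2 = d.+1)%N.
  rewrite mem_undup => /flatten_mapP[w]; rewrite mem_words => /eqP <-.
  exact: size_unshuffle.
have hpart_r : hpart d.+1 L *+ d.+1 = \sum_(p <- r)
    (\sum_(w <- shuffle p.1 p.2) L (FMonom w)) *: (rbracket p.1 * monom p.2).
  rewrite hpartE -sumrMnl.
  transitivity (\sum_(w <- words d.+1) \sum_(p <- r)
     (L (FMonom w) *+ count_mem p (unshuffle w)) *: (rbracket p.1 * monom p.2)).
    rewrite big_seq [RHS]big_seq; apply: eq_bigr => w ww.
    have wd : size w = d.+1 by apply/eqP; rewrite -mem_words.
rewrite scalerMnr -wd -sum_rbracket_unshuffle.
    rewrite (@sum_count _ _ (fun p => rbracket p.1 * monom p.2) r) // => [|p pw].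
      rewrite scaler_sumr; apply: eq_bigr => p _.
      by rewrite -scalerMnr scalerMnl.
    by rewrite mem_undup; apply/flatten_mapP; exists w.
  rewrite exchange_big /= big_seq [RHS]big_seq; apply: eq_bigr => -[u v] /r_size uvd.
  by rewrite -scaler_suml -sum_words_shuffle uvd.
have -> : hpart d.+1 L = (d.+1%:R)^-1 *: (hpart d.+1 L *+ d.+1).
  by rewrite -scaler_nat scalerA mulVf ?scale1r // natrS_neq0.
apply: free_lie_scale; rewrite hpart_r; apply: free_lie_sum => -[u v] _ /=.
case: u => [|a u]; first by rewrite [_ * _]mul0r scaler0; exact: free_lie_zero.
case: v => [|b v]; last by rewrite primL // scale0r; exact: free_lie_zero.
rewrite monom_nil mulr1; apply: free_lie_scale; exact: free_lie_rbracket.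
Qed.

End FreeAlgebra.

(** * The multilinear part of the Campbell-Baker-Hausdorff series *)

Section CBH.
Variables (K : fieldType) (char0 : [pchar K] =i pred0).

(** The value of logS on a group-like series is not the default one: the
    logarithm exists and has Lie components. *)
Lemma logS_spec n (X : series K n) : shuffle_char X ->
  lie_series (logS X) /\ expS (logS X) = X.
Proof.
move=> charX; have [L L0 EL] := log_exists charX.1.
have primL := shuffle_char_log char0 L0 EL charX.
have lieL : lie_series L by exact: dynkin.
by apply: (@xgetPex _ 0 [set L : series K n | lie_series L /\ expS L = X]%classic); exists L.
Qed.

Section ExpGen.
Variables (n : nat).
Implicit Types (i a : 'I_n) (u v w : seq 'I_n).

Lemma genSE i w : genS K i (FMonom w) = (w == [:: i])%:R.
Proof. by rewrite /genS fmuE fmP. Qed.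

Lemma genS_mul i (X : series K n) a w :
  (genS K i * X) (FMonom (a :: w)) = (a == i)%:R * X (FMonom w).
Proof.
rewrite series_mulE big_cuts_cons genSE mul0r add0r.
have [->|ai] := eqVneq a i; last first.
  by rewrite mul0r big1 // => p _; rewrite genSE eqseq_cons (negPf ai) mul0r.
rewrite mul1r; case: w => [|b w]; first by rewrite big_seq1 genSE eqxx mul1r.
rewrite big_cuts_cons genSE eqxx mul1r big1 ?addr0 // => p _.
by rewrite genSE eqseq_cons andbF mul0r.
Qed.

Lemma genS_exp i j w : (genS K i ^+ j) (FMonom w) = (w == nseq j i)%:R.
Proof.
elim: j w => [|j IHj] w; first by rewrite expr0 series_oneE.
rewrite exprS; case: w => [|a w]; first by rewrite series_mul_nil genSE mul0r.
by rewrite genS_mul IHj eqseq_cons -natrM mulnb.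
Qed.

(** Explicitly, exp (x_i) is the sum of the words x_i ^ d / d!. *)
Lemma expS_genS i w :
  expS (genS K i) (FMonom w) = (all (pred1 i) w)%:R / (size w)`!%:R.
Proof.
rewrite /expS big_ord_recr /= big1 ?add0r => [|j _].
  rewrite genS_exp mulrC; congr ((nat_of_bool _)%:R / _).
  by apply/idP/idP => [/eqP->|/all_pred1P/eqP//]; rewrite all_pred1_nseq.
rewrite genS_exp; case: eqP => [wE|_]; last by rewrite mulr0.
by have := ltn_ord j; rewrite {2}wE size_nseq ltnn.
Qed.

(** The words of lengths a and b have binomial (a + b, a) shuffles, and
    1 / a! * 1 / b! is this binomial coefficient divided by (a + b)!. *)
Lemma shuffle_char_expS_genS i : shuffle_char (expS (genS K i)).
Proof.
split=> [|u v]; first exact: expS_nil.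
transitivity (\sum_(w <- shuffle u v)
    (all (pred1 i) u && all (pred1 i) v)%:R / (size u + size v)`!%:R : K).
  rewrite big_seq [RHS]big_seq; apply: eq_bigr => w /shuffle_perm wuv.
  by rewrite expS_genS (perm_all _ wuv) (perm_size wuv) all_cat size_cat.
rewrite big_const_seq count_predT iter_addr_0 size_shuffle !expS_genS.
rewrite mulrACA -natrM mulnb -mulrnAr; congr (_ * _).
have := bin_fact (leq_addr (size v) (size u)); rewrite addKn => <-.
rewrite !natrM !invfM -mulr_natr mulrC mulVKf //.
by rewrite natr_eq0 // -lt0n bin_gt0 leq_addr.
Qed.

(** In a word without repetition each factor exp (x_i) contributes 1 or x_i,
    in the order of the factors. *)
Lemma prod_expS_genS (s : seq 'I_n) w : uniq s -> uniq w ->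
  (\prod_(i <- s) expS (genS K i)) (FMonom w) = (subseq w s)%:R.
Proof.
elim: s w => [|i s IHs] w; first by rewrite big_nil series_oneE.
move=> /= /andP[i_s s_uniq] w_uniq; rewrite big_cons.
case: w w_uniq => [_|a w /= /andP[a_w w_uniq]].
  by rewrite series_mul_nil expS_nil mul1r IHs // sub0seq.
rewrite series_mulE big_cuts_cons expS_nil mul1r IHs /= ?a_w //.
have eE p : p \in cuts w ->
    expS (genS K i) (FMonom (a :: p.1)) = ((p.1 == [::]) && (a == i))%:R.
  move=> /cutsP pw; rewrite expS_genS; case: p.1 pw => [|c x] pw /=.
    by rewrite andbT divr1.
  rewrite [_ && _](_ : _ = false) ?mul0r //; apply: contraNF a_w.
  by case/and3P=> /eqP-> /eqP <- _; rewrite -pw mem_head.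
transitivity ((subseq (a :: w) s)%:R + ((a == i) && subseq w s)%:R : K).
  congr (_ + _); rewrite big_seq.
  under eq_bigr do rewrite eE //.
  rewrite -big_seq; case: {a_w eE}w w_uniq => [|b w] w_uniq.
    by rewrite big_seq1 eqxx /= IHs // -natrM mulnb.
  rewrite big_cuts_cons eqxx IHs // -natrM mulnb big1 ?addr0 // => p _.
  by rewrite mul0r.
rewrite eq_sym; have [<-|_] := eqVneq i a; last by rewrite addr0.
rewrite [subseq (i :: w) s](_ : _ = false) ?add0r //.
by apply: contraNF i_s => /mem_subseq->; rewrite ?mem_head.
Qed.

End ExpGen.

Definition bch (k : nat) : series K k := \prod_(i < k) expS (genS K i).
Arguments bch : clear implicits.

Lemma shuffle_char_bch k : shuffle_char (bch k).
Proof.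
apply: big_ind => [||i _]; [exact: shuffle_char1|exact: shuffle_charM|].
exact: shuffle_char_expS_genS.
Qed.

Lemma bch_perm k (w : seq 'I_k) : perm_eq w (enum 'I_k) ->
  bch k (FMonom w) = (w == enum 'I_k)%:R.
Proof.
move=> wk; have -> : bch k = \prod_(i <- enum 'I_k) expS (genS K i).
  by rewrite /bch [index_enum _]unlock enumT.
rewrite prod_expS_genS ?enum_uniq // ?(perm_uniq wk) ?enum_uniq //.
congr (nat_of_bool _)%:R; apply/idP/eqP => [|->]; last exact: subseq_refl.
by move/size_subseq_leqif => [_]; rewrite (perm_size wk) eqxx => /esym/eqP.
Qed.

Lemma perm_tupleE k (s : k.-tuple 'I_k) :
  [forall i, count_mem i s == 1%N] = perm_eq s (enum 'I_k).
Proof.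
apply/forallP/idP => [s1|sk i].
  apply/allP => i _; rewrite /= (eqP (s1 i)) count_uniq_mem ?enum_uniq //.
  by rewrite mem_enum.
by rewrite (permP sk) count_uniq_mem ?enum_uniq // mem_enum.
Qed.

Lemma map_tnth_perm k (T : eqType) (v : k.-tuple T) (t : seq 'I_k) :
  perm_eq t (enum 'I_k) -> perm_eq (map (tnth v) t) v.
Proof.
by move=> tk; rewrite (permPl (perm_map (tnth v) tk)) map_tnth_enum.
Qed.

(** A rearrangement t of the positions, read as a permutation, has an inverse:
    s sends i to the place of i in t. *)
Lemma perm_inverse k (t : seq 'I_k) : perm_eq t (enum 'I_k) ->
  exists2 s : k.-tuple 'I_k, perm_eq s (enum 'I_k) & map (tnth s) t = enum 'I_k.
Proof.
move=> tk; have t_uniq : uniq t by rewrite (perm_uniq tk) enum_uniq.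
have t_size : size t = k by rewrite (perm_size tk) size_enum_ord.
pose s := [tuple insubd i (index i t) | i < k].
have sE : map (tnth s) t = enum 'I_k.
  apply: (inj_map val_inj); rewrite val_enum_ord -map_comp.
  apply: (@eq_from_nth _ 0%N) => [|j]; rewrite size_map ?size_iota // => jt.
  have jk : (j < k)%N by rewrite -t_size.
  rewrite nth_iota // (nth_map (Ordinal jk)) //= tnth_mktuple val_insubd.
  by rewrite index_uniq // jk.
exists s => //; rewrite -sE perm_sym; exact: map_tnth_perm.
Qed.

(** The last factor forces s to be the inverse of t, and then the middle factor
    forces v = w o t. *)
Lemma sum_perm_inverse k n (X : series K n) (w : k.-tuple 'I_n)
    (t : seq 'I_k) : perm_eq t (enum 'I_k) ->
  \sum_(v : k.-tuple 'I_n) \sum_(s : k.-tuple 'I_k | perm_eq s (enum 'I_k))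
     X (FMonom v) * (map (tnth v) s == w)%:R * (map (tnth s) t == enum 'I_k)%:R
  = X (FMonom (map (tnth w) t)).
Proof.
move=> tk; have [s0 s0k s0t] := perm_inverse tk.
have sE (s : k.-tuple 'I_k) : (map (tnth s) t == enum 'I_k) = (s == s0).
  apply/eqP/eqP => [st|->//]; apply: eq_from_tnth => i.
  have : i \in t by rewrite (perm_mem tk) mem_enum.
  by move: i; apply/eq_in_map; rewrite st s0t.
have vE (v : k.-tuple 'I_n) :
    (map (tnth v) s0 == w) = (tval v == map (tnth w) t).
  have vE : tval v = map (fun i => tnth v (tnth s0 i)) t.
    by rewrite (map_comp (tnth v)) s0t map_tnth_enum.
  apply/eqP/eqP => [vw|vt].
    rewrite vE; apply: eq_map => i; rewrite -(tnth_map (tnth v) s0).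
    by congr tnth; apply: val_inj.
  have vs0 i : tnth v (tnth s0 i) = tnth w i.
    have : i \in t by rewrite (perm_mem tk) mem_enum.
    by move: i; apply/eq_in_map; rewrite -vE vt.
  rewrite -[RHS]map_tnth_enum -[in LHS](map_tnth_enum s0) -map_comp.
  exact: eq_map.
have szt : size (map (tnth w) t) == k by rewrite size_map (perm_size tk) size_enum_ord.
rewrite (bigD1 (Tuple szt)) //= [X in _ + X]big1 ?addr0 => [|v vt]; last first.
  rewrite big1 // => s _; rewrite sE; have [->|_] := eqVneq s s0; last by rewrite mulr0.
  by rewrite vE [_ == _](negPf vt) mulr0 mul0r.
rewrite (bigD1 s0) //= big1 ?addr0 => [|s /andP[_ /negPf ss]]; last first.
  by rewrite sE ss mulr0.
by rewrite vE s0t !eqxx !mulr1.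
Qed.

(** At T = t both sides are sums of X (w o r) over r in deal t (enum 'I_k): on
    the left by deal_exp, on the right because (bch k ^+ t) s is the
    multiplicity of s^-1 in this list. *)
Lemma exp_poly_bch n (X L : series K n) k (w : k.-tuple 'I_n) (M : series K k) :
    shuffle_char X -> L (FMonom [::]) = 0 -> expS L = X ->
    M (FMonom [::]) = 0 -> expS M = bch k ->
  exp_poly L w = \sum_(v : k.-tuple 'I_n)
    \sum_(s : k.-tuple 'I_k | perm_eq s (enum 'I_k))
      (X (FMonom v) * (map (tnth v) s == w)%:R) *: exp_poly M s.
Proof.
move=> charX L0 EL M0 EM; apply: (poly_eq_nat char0) => t.
have dealE m (v : k.-tuple 'I_m) :
    deal t v = map (map (tnth v)) (deal t (enum 'I_k)).
  by rewrite -map_deal map_tnth_enum.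
rewrite exp_poly_nat // EL (deal_exp t w charX) horner_sum dealE big_map big_seq.
under eq_bigr => r rt do rewrite -(sum_perm_inverse X w (deal_perm rt)).
rewrite -big_seq exchange_big; apply: eq_bigr => v _.
rewrite exchange_big horner_sum; apply: eq_bigr => s sk.
rewrite hornerZ exp_poly_nat // EM (deal_exp t s (shuffle_char_bch k)) dealE.
rewrite big_map mulr_sumr big_seq [RHS]big_seq; apply: eq_bigr => r /deal_perm rk.
by rewrite bch_perm // (permPl (map_tnth_perm s rk)).
Qed.

(** The linear coefficient of exp_poly_bch. *)
Lemma log_bch n (X L : series K n) k (w : k.-tuple 'I_n) (M : series K k) :
    shuffle_char X -> L (FMonom [::]) = 0 -> expS L = X ->
    M (FMonom [::]) = 0 -> expS M = bch k ->
  L (FMonom w) = \sum_(v : k.-tuple 'I_n)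
    \sum_(s : k.-tuple 'I_k | perm_eq s (enum 'I_k))
      X (FMonom v) * (map (tnth v) s == w)%:R * M (FMonom s).
Proof.
move=> charX L0 EL M0 EM.
rewrite -(exp_poly_coef1 w L0) (exp_poly_bch w charX L0 EL M0 EM) coef_sum.
apply: eq_bigr => v _; rewrite coef_sum; apply: eq_bigr => s _.
by rewrite coefZ exp_poly_coef1.
Qed.

Lemma prod_genF n (T : Type) (f : T -> 'I_n) (r : seq T) :
  \prod_(j <- r) genF K (f j) = monom K (map f r).
Proof.
elim: r => [|j r IHr]; first by rewrite big_nil monom_nil.
by rewrite big_cons IHr -monom_cons.
Qed.

Lemma mcoeff_cbh_monom n k (v : k.-tuple 'I_n) (w : seq 'I_n) : (0 < k)%N ->
  (cbh_monom K (FMonom v))@_(FMonom w) =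
  \sum_(s : k.-tuple 'I_k | perm_eq s (enum 'I_k))
     logS (bch k) (FMonom s) * (map (tnth v) s == w)%:R.
Proof.
case: v => v vk; have vk' := eqP vk; subst k => v0.
have -> : Tuple vk = in_tuple v by apply: val_inj.
rewrite /cbh_monom /= ifN ?(lt0n_neq0 v0) //.
rewrite /evalF /CBH /multilinear_part mmapC_sum raddf_sum /=.
under eq_bigl do rewrite perm_tupleE.
apply: eq_bigr => s _; rewrite mmapU /= mcoeffCM; congr (_ * _).
by rewrite prod_genF mcoeffU1 fmP.
Qed.

Lemma log_cbh n (X : series K n) : shuffle_char X -> logS X = cbhS X.
Proof.
move=> charX; have [lieL EL] := logS_spec charX.
have L0 := lie_series_nil lieL.
apply: series_ext => w; rewrite /cbhS /cbh /hpart mmapC_sum raddf_sum /=.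
have [->|w0] := eqVneq w [::].
  rewrite L0 big1 // => v _; rewrite mmapU /= mcoeffCM.
  by rewrite /cbh_monom ifT ?mcoeff0 ?mulr0 //= size_tuple.
have [lieM EM] := logS_spec (shuffle_char_bch (size w)).
have M0 := lie_series_nil lieM.
rewrite [LHS](log_bch (in_tuple w) charX L0 EL M0 EM); apply: eq_bigr => v _.
rewrite mmapU /= mcoeffCM mcoeff_cbh_monom ?lt0n ?size_eq0 // mulr_sumr.
by apply: eq_bigr => s _; rewrite -mulrA; congr (_ * _); rewrite mulrC.
Qed.

End CBH.

Theorem proposition1 (K : fieldType) (char0 : [pchar K] =i pred0)
    (n : nat) (n_ge1 : (1 <= n)%N) (X : series K n) :
  group_like X -> logS X = cbhS X.
Proof. by move/group_like_char; exact: log_cbh. Qed.
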